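(* Let $X$ be a Banach space. For every $X$-valued cylindrical function $F\in\mathscr{C}(\Omega;X)$ and every $B\in\mathcal{E}_\mu$, $$\mathbb{E}\int_B DF\,\mathrm{d}\mu=\mathbb{E}\big(\tilde N(B)F\big).$$
   Context: Poisson random measure: $(\Omega,\mathcal{F},\mathbb{P})$ is a probability space, $(E,\mathcal{E})$ a measurable space, and $N$ is a Poisson random measure on $(E,\mathcal{E})$ with $\sigma$-finite intensity measure $\mu$, i.e. a map $N:\Omega\times\mathcal{E}\to\mathbb{N}\cup\{\infty\}$ such that $N(B)$ is a random variable for each $B\in\mathcal{E}$, $N(\omega,\cdot)$ is a measure for each $\omega$, $N(B)$ is Poisson distributed with parameter $\mu(B)$ ($N(B)=\infty$ a.s. if $\mu(B)=\infty$), and $N(B_1),\dots,N(B_n)$ are independent for pairwise disjoint $B_1,\dots,B_n$. Put $\mathcal{E}_\mu=\{B\in\mathcal{E}:\mu(B)<\infty\}$ and $\tilde N(B)=N(B)-\mu(B)$ for $B\in\mathcal{E}_\mu$. Cylindrical functions: a (real) cylindrical function is a random variable $F=f(N(B_1),\dots,N(B_M))$ with $M\ge 1$, $f:\mathbb{N}^M\to\mathbb{R}$ ($0\in\mathbb{N}$) and $B_1,\dots,B_M\in\mathcal{E}_\mu$, which may always be taken pairwise disjoint. $\mathscr{C}(\Omega)$ is the real vector space of these, and $\mathscr{C}(\Omega;X)=\mathscr{C}(\Omega)\otimes X$ consists of all $F=\sum_{i=1}^n F_i\otimes x_i$ with $n\ge1$, $F_i\in\mathscr{C}(\Omega)$,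 $x_i\in X$. Malliavin derivative: writing $F=\sum_{i=1}^n f_i(N(\mathbf{B}))\otimes x_i\in\mathscr{C}(\Omega;X)$ with $N(\mathbf{B})=(N(B_1),\dots,N(B_M))$, $B_1,\dots,B_M\in\mathcal{E}_\mu$ pairwise disjoint, and $\mathbf{e}_m$ the $m$-th unit vector of $\mathbb{R}^M$, $$DF=\sum_{i=1}^n\sum_{m=1}^M\big(f_i(N(\mathbf{B})+\mathbf{e}_m)-f_i(N(\mathbf{B}))\big)\otimes(\mathbf 1_{B_m}\otimes x_i),$$ a random variable with values in $L^2(E,\mu)\otimes X$; it does not depend on the representation of $F$.
   Formalization: Since f is arbitrary, the expectations need not exist (e.g. F=(N(B)!)² with μ(B)=1); the formal statement assumes that both E∫_B DF dμ and E(Ñ(B)F) exist as Bochner integrals. *)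

(* Defs.v *)
From HB Require Import structures.
From mathcomp Require Export all_boot all_order all_algebra.
From mathcomp Require Export all_classical all_reals all_analysis measurable_realfun.
Export Order.TTheory GRing.Theory Num.Theory.
Export numFieldNormedType.Exports.

Set Implicit Arguments.
Unset Strict Implicit.
Unset Printing Implicit Defensive.

Local Open Scope classical_set_scope.
Local Open Scope ring_scope.

Section Bochner.
Context {d : measure_display} {T : measurableType d} {R : realType}.
Context {X : completeNormedModType R}.
Variables (mu : {measure set T -> \bar R}) (D : set T).

(* The list [:: (A_1, x_1); ...; (A_k, x_k)] stands for the simple function
   1_{A_1} (x) x_1 + ... + 1_{A_k} (x) x_k; the sets A_j may overlap. *)
Definition simple_fun (s : seq (set T * X)) (t : T) : X :=
  \sum_(p <- s) (\1_(p.1) t : R) *: p.2.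

Definition simple_integral (s : seq (set T * X)) : X :=
  \sum_(p <- s) fine (mu (p.1 `&` D)) *: p.2.

(* mu-simple on D: steps are measurable, of finite measure inside D *)
Definition is_mu_simple (s : seq (set T * X)) : Prop :=
  forall p, p \in s -> measurable p.1 /\ (mu (p.1 `&` D) < +oo)%E.

(* f is Bochner integrable over D with integral v: some sequence of mu-simple
   functions converges to f mu-a.e. on D and in L^1-distance on D, and its
   integrals converge to v.  (The a.e. convergence is the strong
   mu-measurability of f.) *)
Definition is_bochner_integral (f : T -> X) (v : X) : Prop :=
  exists s : nat -> seq (set T * X),
    [/\ forall k, is_mu_simple (s k),
        {ae mu, forall t, D t -> simple_fun (s k) t @[k --> \oo] --> f t},
        (\int[mu]_(t in D) `|f t - simple_fun (s k) t|%:E)%E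
          @[k --> \oo] --> 0%E
      & simple_integral (s k) @[k --> \oo] --> v].

Definition bochner_integrable (f : T -> X) : Prop :=
  exists v, is_bochner_integral f v.

(* 0 when f is not Bochner integrable *)
Definition bochner_integral (f : T -> X) : X :=
  xget 0 [set v | is_bochner_integral f v].

End Bochner.

Section Poisson.
Context {dO dE : measure_display} {Omega : measurableType dO}.
Context {E : measurableType dE} {R : realType}.
Variables (P : probability Omega R) (mu : {measure set E -> \bar R}).

(* The library's poisson_pmf is the constant 1 at rate 0; here 0 ^+ 0 = 1 gives
   the Dirac mass at 0. *)
Definition poisson_mass (rate : R) (k : nat) : R :=
  expR (- rate) * rate ^+ k / k`!%:R.

Definition mutually_independent (d : measure_display) (T : measurableType d)
    (n : nat) (Y : 'I_n -> Omega -> T) : Prop :=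
  forall A : 'I_n -> set T, (forall i, measurable (A i)) ->
    P (\bigcap_(i in [set: 'I_n]) Y i @^-1` A i)
    = (\prod_(i < n) P (Y i @^-1` A i))%E.

Definition poisson_random_measure
    (N : Omega -> {measure set E -> \bar R}) : Prop :=
  [/\ forall w B, measurable B ->
        N w B = +oo%E \/ exists k : nat, N w B = k%:R%:E,
      forall B, measurable B -> measurable_fun [set: Omega] (fun w => N w B),
      forall B, measurable B -> (mu B < +oo)%E ->
        forall k : nat, P [set w | N w B = k%:R%:E]
                        = (poisson_mass (fine (mu B)) k)%:E,
      forall B, measurable B -> mu B = +oo%E -> {ae P, forall w, N w B = +oo%E}
    & forall (n : nat) (B : 'I_n -> set E), (forall i, measurable (B i)) ->
        trivIset [set: 'I_n] B ->
        mutually_independent (fun i w => N w (B i))].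

Definition finite_measure_sets : set (set E) :=
  [set B | measurable B /\ (mu B < +oo)%E].

Variable N : Omega -> {measure set E -> \bar R}.

Definition compensated (B : set E) (w : Omega) : R :=
  fine (N w B) - fine (mu B).

(* (N(B_1), ..., N(B_M)) as an element of nat^M; for B_m of finite measure the
   event N(B_m) = oo is P-null, and the entry is 0 there. *)
Definition counts (M : nat) (B : 'I_M -> set E) (w : Omega) : 'I_M -> nat :=
  fun m => Num.truncn (fine (N w (B m))).

(* Random variables are identified when they agree almost surely. *)
Definition cylindrical (F : {RV P >-> R}) : Prop :=
  exists (M : nat) (f : ('I_M -> nat) -> R) (B : 'I_M -> set E),
    [/\ (0 < M)%N, forall m, finite_measure_sets (B m)
      & {ae P, forall w, F w = f (counts B w)}].

Variable X : completeNormedModType R.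

Definition vcylindrical (F : Omega -> X) : Prop :=
  exists (n : nat) (Fi : 'I_n -> {RV P >-> R}) (x : 'I_n -> X),
    [/\ (0 < n)%N, forall i, cylindrical (Fi i)
      & {ae P, forall w, F w = \sum_(i < n) Fi i w *: x i}].

Definition add_unit (M : nat) (k : 'I_M -> nat) (m : 'I_M) : 'I_M -> nat :=
  fun j => (k j + (j == m))%N.

Definition malliavin_repr (n M : nat) (f : 'I_n -> ('I_M -> nat) -> R)
    (B : 'I_M -> set E) (x : 'I_n -> X) (w : Omega) (e : E) : X :=
  \sum_(i < n) \sum_(m < M)
    (f i (add_unit (counts B w) m) - f i (counts B w))
      *: ((\1_(B m) e : R) *: x i).

(* DF is obtained from some representation of F over pairwise disjoint sets.
   An element of L^2(E, mu) (x) X is given as a function E -> X. *)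
Definition is_malliavin_derivative (F : Omega -> X) (DF : Omega -> E -> X) :=
  exists (n M : nat) (f : 'I_n -> ('I_M -> nat) -> R)
         (B : 'I_M -> set E) (x : 'I_n -> X),
    [/\ (0 < n)%N /\ (0 < M)%N,
        forall m, finite_measure_sets (B m),
        trivIset [set: 'I_M] B,
        {ae P, forall w, F w = \sum_(i < n) f i (counts B w) *: x i}
      & DF = malliavin_repr f B x].

(* D F, by choice of a representation; two representations of F give the same
   element of L^2(E, mu) (x) X almost surely. *)
Definition malliavin (F : Omega -> X) : Omega -> E -> X :=
  xget (fun _ _ => 0) [set DF | is_malliavin_derivative F DF].

End Poisson.

(* Main.v *)
Require Import Defs.
From mathcomp Require Import ring lra.

(** Let [B_1, ..., B_M] be the disjoint sets of a representation of [F].  The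
    sets [B_m] and [B] are unions of members of one disjoint family
    [A_1, ..., A_n] of sets of finite measure ([disjoint_refinement]).  Put
    [lam_j = mu(A_j)], let [S] be the set of the [j] with [A_j] inside [B], and
    write [F = g(K)] with [K = (N(A_1), ..., N(A_n))].  Almost surely, the
    integral of [DF] over [B] and the product of the compensated mass of [B]
    with [F] are the values at [K] of
<<
      gradient k = sum_(j in S) lam_j (g(k + e_j) - g(k)),
      centred k  = (sum_(j in S) k_j - sum_(j in S) lam_j) g(k).
>>
    The law [p] of [K] is a product of Poisson laws, so that
    [lam_j p(k) = (k_j + 1) p(k + e_j)].  Multiplied by [p(k)] and summed over
    a box of lattice points, the two functions therefore differ only by boundary
    terms [k_j p(k) g(k)] ([box_shift]), and those vanish in the limit as soon
    as the series of [(sum_(j in S) k_j) p(k) |g(k)|] converges.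

    The function [g] is arbitrary and [F] need not be integrable, so this
    convergence is deduced from the integrability of the two sides together
    ([total_summable]).  Integrability of [centred] controls [g] at
    all points [k] where [sum_(j in S) k_j] differs from [L = sum_(j in S)
    lam_j].  When [L] is an integer, nothing is known yet on the layer
    [sum_(j in S) k_j = L]; but a unit step in a direction of [S] leaves that
    layer, so on it [L g] equals [- gradient] plus a combination of
    values of [g] that are already controlled.

    No duality is used to pass from scalars to the Banach space [X]: a Bochner
    integral [v] of [f] satisfies [|v - I(s)| <= int |f - s|] for every simple
    function [s] with integral [I(s)] ([bochner_integral_dist]), which makes
    the integral of a function of [K] the sum of an absolutely convergent
    series, with an explicit bound for the remainder
    ([bochner_discrete_tail]). *)

Set Implicit Arguments.
Unset Strict Implicit.

Local Open Scope classical_set_scope.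
Local Open Scope ring_scope.

(** * Integrals of almost measurable functions *)

Lemma measurable_fun_mem {d : measure_display} {T : measurableType d}
    (D A : set T) :
  measurable D -> measurable A -> measurable_fun D (fun t => t \in A).
Proof.
move=> mD mA; apply: (@measurable_fun_bool _ _ _ _ true).
rewrite [X in measurable X](_ : _ = D `&` A); first exact: measurableI.
by apply/seteqP; split=> t [Dt At]; split => //; [exact: set_mem|exact: mem_set].
Qed.

Lemma measure_sub_lty {d : measure_display} {T : measurableType d}
    {R : realType} (mu : {measure set T -> \bar R}) (A B : set T) :
  measurable A -> measurable B -> A `<=` B -> (mu B < +oo)%E ->
  (mu A < +oo)%E.
Proof. by move=> mA mB AB; apply: le_lt_trans; apply: le_measure; rewrite ?inE. Qed.

(** The integral of a nonnegative function is a supremum over the simple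
    functions below it, hence makes sense, as a lower integral, for functions
    that are not measurable.  Integrands that are only almost everywhere equal
    to measurable ones are compared in this sense. *)
Section LowerIntegral.
Context {d : measure_display} {T : measurableType d} {R : realType}.
Variable mu : {measure set T -> \bar R}.
Implicit Types (D : set T) (f g : T -> \bar R).
Local Open Scope ereal_scope.

Lemma le_integral_lower D f g :
  (forall t, D t -> 0 <= f t) -> (forall t, D t -> f t <= g t) ->
  \int[mu]_(t in D) f t <= \int[mu]_(t in D) g t.
Proof.
move=> f0 fg.
have g0 t : D t -> 0 <= g t by move=> Dt; exact: le_trans (f0 _ Dt) (fg _ Dt).
rewrite !ge0_integralE//; apply: ereal_sup_le => _ [h hf <-]; exists h => // t.
apply: le_trans (hf t) _; rewrite !patchE; case: ifPn => // /set_mem.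
exact: fg.
Qed.

Lemma ae_le_integral_measurable_left D f g : measurable D ->
  measurable_fun D f -> (forall t, D t -> 0 <= f t) ->
  (forall t, D t -> 0 <= g t) ->
  {ae mu, forall t, D t -> f t <= g t} ->
  \int[mu]_(t in D) f t <= \int[mu]_(t in D) g t.
Proof.
move=> mD mf f0 g0 [A [mA A0 sA]].
rewrite (ge0_negligible_integral mA)// setDE integral_mkcondr.
apply: le_integral_lower => t Dt; rewrite patchE; case: ifPn => //.
- by move=> _; exact: f0.
- rewrite inE => nAt; apply: contrapT => fg; apply: nAt; apply: sA => /=.
  by move=> /(_ Dt).
- by move=> _; exact: g0.
Qed.

Lemma ae_le_integral_measurable_right D f g : measurable D ->
  measurable_fun D g -> (forall t, D t -> 0 <= f t) ->
  (forall t, D t -> 0 <= g t) ->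
  {ae mu, forall t, D t -> f t <= g t} ->
  \int[mu]_(t in D) f t <= \int[mu]_(t in D) g t.
Proof.
move=> mD mg f0 g0 [A [mA A0 sA]].
(* the majorant [h] of [f] has the integral of [g] because [A] is null *)
pose h t := if t \in A then +oo else g t.
have h0 t : D t -> 0 <= h t.
  by move=> Dt; rewrite /h; case: ifPn => _ //; exact: g0.
have mh : measurable_fun D h.
  apply: measurable_fun_if => //; last exact: measurable_funS mg.
  exact: measurable_fun_mem.
have -> : \int[mu]_(t in D) g t = \int[mu]_(t in D) h t.
  apply: ge0_ae_eq_integral => //; exists A; split => // t /= gh.
  apply: contrapT => At; apply: gh => _.
  by rewrite /h ifN// notin_setE.
apply: le_integral_lower => // t Dt; rewrite /h; case: ifPn => [_|].
  by rewrite leey.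
rewrite notin_setE => nAt; apply: contrapT => fg; apply: nAt; apply: sA => /=.
by move=> /(_ Dt).
Qed.

Lemma ae_eq_integral_measurable_right D f g : measurable D ->
  measurable_fun D g -> (forall t, D t -> 0 <= f t) ->
  (forall t, D t -> 0 <= g t) ->
  {ae mu, forall t, D t -> f t = g t} ->
  \int[mu]_(t in D) f t = \int[mu]_(t in D) g t.
Proof.
move=> mD mg f0 g0 fg; apply/eqP; rewrite eq_le; apply/andP; split.
  apply: ae_le_integral_measurable_right => //.
  by apply: filterS fg => t H Dt; rewrite H.
apply: ae_le_integral_measurable_left => //.
by apply: filterS fg => t H Dt; rewrite H.
Qed.

End LowerIntegral.

(** * Bochner integrals *)

Section BochnerTheory.
Context {d : measure_display} {T : measurableType d} {R : realType}.
Context {X : completeNormedModType R}.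
Variables (mu : {measure set T -> \bar R}) (D : set T).
Hypothesis mD : measurable D.
Implicit Types (s : seq (set T * X)) (f : T -> X) (v : X).

Lemma simple_fun_cons p s t :
  simple_fun (p :: s) t = (\1_(p.1) t : R) *: p.2 + simple_fun s t.
Proof. by rewrite /simple_fun big_cons. Qed.

(** The list standing for the opposite simple function. *)
Definition simple_opp s : seq (set T * X) := [seq (p.1, - p.2) | p <- s].

Lemma simple_fun_sub s s' t :
  simple_fun (s ++ simple_opp s') t = simple_fun s t - simple_fun s' t.
Proof.
rewrite /simple_fun big_cat big_map /= -sumrN; congr (_ + _).
by apply: eq_bigr => p _; rewrite scalerN.
Qed.

Lemma simple_integral_sub s s' :
  simple_integral mu D (s ++ simple_opp s')
  = simple_integral mu D s - simple_integral mu D s'.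
Proof.
rewrite /simple_integral big_cat big_map /= -sumrN; congr (_ + _).
by apply: eq_bigr => p _; rewrite scalerN.
Qed.

Lemma is_mu_simple_sub s s' : is_mu_simple mu D s -> is_mu_simple mu D s' ->
  is_mu_simple mu D (s ++ simple_opp s').
Proof.
move=> hs hs' p; rewrite mem_cat => /orP[/hs//|/mapP[q /hs' hq ->]]; exact: hq.
Qed.

Lemma is_mu_simple_cons p s : is_mu_simple mu D (p :: s) ->
  [/\ measurable p.1, (mu (p.1 `&` D) < +oo)%E & is_mu_simple mu D s].
Proof.
move=> h; have [h1 h2] := h p (mem_head _ _); split => // q qs; apply: h.
by rewrite inE qs orbT.
Qed.

(** No measurable structure on the values is needed: a simple function takes
    finitely many values, each on a measurable set. *)
Lemma measurable_simple_fun_comp s (phi : X -> \bar R) : is_mu_simple mu D s ->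
  measurable_fun [set: T] (fun t => phi (simple_fun s t)).
Proof.
elim: s phi => [|p s IH] phi.
  move=> _; under eq_fun do rewrite /simple_fun big_nil; exact: measurable_cst.
move=> /is_mu_simple_cons[mp _ hs].
rewrite [X in measurable_fun _ X](_ : _ = fun t => if t \in p.1 then
   phi (p.2 + simple_fun s t) else phi (simple_fun s t)); last first.
  apply/funext => t; rewrite simple_fun_cons indicE.
  by case: ifP => _; rewrite ?scale1r ?scale0r ?add0r.
have mI := IH ((fun x => phi (p.2 + x))) hs.
apply: measurable_fun_if => //.
- exact: measurable_fun_mem.
- by apply: measurable_funS mI.
- by apply: measurable_funS (IH phi hs).
Qed.

Lemma measurable_norm_simple_fun A s : is_mu_simple mu D s ->
  measurable_fun A (fun t => `|simple_fun s t|%:E).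
Proof.
move=> hs; apply: (@measurable_funS _ _ _ _ setT) => //.
exact: (@measurable_simple_fun_comp s (fun x => `|x|%:E)).
Qed.

(** The triangle inequality for a simple function over possibly overlapping
    steps.  The domain [C] and the constant [y] are there for the induction:
    removing a step [p] cuts [C] along [p.1] and adds [p.2] to [y] on one of the
    two parts. *)
Lemma norm_simple_integral_on C y s : measurable C -> (mu C < +oo)%E ->
    is_mu_simple mu D s ->
  (`|\sum_(p <- s) fine (mu (p.1 `&` C)) *: p.2 + fine (mu C) *: y|%:E
   <= \int[mu]_(t in C) `|simple_fun s t + y|%:E)%E.
Proof.
elim: s C y => [|p s IH] C y mC Cfin.
  move=> _; rewrite big_nil add0r /simple_fun.
  under eq_integral do rewrite big_nil add0r.
  rewrite integral_cst// normrZ ger0_norm ?fine_ge0// EFinM fineK ?ge0_fin_numE//.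
  by rewrite muleC.
move=> hps; have [mp _ hs] := is_mu_simple_cons hps.
have mCp : measurable (C `&` p.1) by exact: measurableI.
have mCn : measurable (C `\` p.1) by exact: measurableD.
have Cpfin : (mu (C `&` p.1) < +oo)%E.
  by apply: measure_sub_lty Cfin => //; exact: subIsetl.
have Cnfin : (mu (C `\` p.1) < +oo)%E.
  by apply: measure_sub_lty Cfin => //; exact: subDsetl.
have split_mu A : measurable A ->
    fine (mu (A `&` C)) = fine (mu (A `&` (C `&` p.1)))
                        + fine (mu (A `&` (C `\` p.1))).
  move=> mA.
  have fin1 : (mu (A `&` (C `&` p.1)) < +oo)%E.
    exact: (measure_sub_lty (measurableI _ _ mA mCp) mCp (@subIsetr _ _ _) Cpfin).
  have fin2 : (mu (A `&` (C `\` p.1)) < +oo)%E.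
    exact: (measure_sub_lty (measurableI _ _ mA mCn) mCn (@subIsetr _ _ _) Cnfin).
  rewrite -fineD ?ge0_fin_numE// -measureU//.
  - by congr (fine (mu _)); rewrite -setIUr -{1}(setUIDK C p.1) setUC.
  - exact: measurableI.
  - exact: measurableI.
  - by rewrite -setIIr setDE setIACA setICr !setI0.
have -> : (\int[mu]_(t in C) `|simple_fun (p :: s) t + y|%:E
   = \int[mu]_(t in C `&` p.1) `|simple_fun s t + (p.2 + y)|%:E
     + \int[mu]_(t in C `\` p.1) `|simple_fun s t + y|%:E)%E.
  rewrite -{1}(setUIDK C p.1) ge0_integral_setU//.
  - congr (_ + _)%E; apply: eq_integral => t; rewrite inE => -[Ct pt];
      rewrite simple_fun_cons indicE.
      by rewrite mem_set// scale1r addrCA addrA.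
    by rewrite memNset// scale0r add0r.
  - apply: (@measurable_funS _ _ _ _ setT) => //.
    apply: (@measurable_simple_fun_comp (p :: s) (fun x => `|x + y|%:E)).
    exact: hps.
  - by rewrite disj_set2E setDE setIACA setICr setI0.
apply: le_trans (leeD (IH _ (p.2 + y) mCp Cpfin hs) (IH _ y mCn Cnfin hs)).
rewrite -EFinD lee_fin; apply: le_trans (ler_normD _ _).
rewrite le_eqVlt; apply/orP; left; apply/eqP; congr (`|_|).
rewrite big_cons.
rewrite (eq_big_seq (fun q => fine (mu (q.1 `&` (C `&` p.1))) *: q.2
    + fine (mu (q.1 `&` (C `\` p.1))) *: q.2)); last first.
  by move=> q /hs[mq _]; rewrite split_mu// scalerDl.
rewrite big_split/= scalerDr.
have -> : fine (mu C) = fine (mu (C `&` p.1)) + fine (mu (C `\` p.1)).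
  by have := split_mu setT measurableT; rewrite !setTI.
rewrite setIC scalerDl.
set a := \sum_(_ <- _) _; set b := \sum_(_ <- _) _.
by rewrite (addrCA _ a b) -[LHS]addrA (addrACA _ b) !addrA.
Qed.

Lemma is_mu_simple_support s : is_mu_simple mu D s ->
  exists C, [/\ measurable C, (mu C < +oo)%E, C `<=` D
    & forall p, p \in s -> p.1 `&` D `<=` C].
Proof.
elim: s => [_|p s IH /is_mu_simple_cons[mp pfin /IH[C [mC Cfin CD sC]]]].
  by exists set0; split => //; rewrite measure0.
exists ((p.1 `&` D) `|` C); split.
- by apply: measurableU => //; exact: measurableI.
- apply: le_lt_trans (measureU2 _ _ _) _ => //; first exact: measurableI.
  exact: lte_add_pinfty.
- by rewrite subUset; split => //; exact: subIsetr.
- move=> q; rewrite inE => /predU1P[->|/sC qC]; first exact: subsetUl.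
  by apply: subset_trans qC _; exact: subsetUr.
Qed.

Lemma norm_simple_integral_le s : is_mu_simple mu D s ->
  (`|simple_integral mu D s|%:E <= \int[mu]_(t in D) `|simple_fun s t|%:E)%E.
Proof.
move=> hs; have [C [mC Cfin CD sC]] := is_mu_simple_support hs.
have := norm_simple_integral_on 0 mC Cfin hs.
rewrite scaler0 addr0.
have -> : \sum_(p <- s) fine (mu (p.1 `&` C)) *: p.2 = simple_integral mu D s.
  apply: eq_big_seq => p ps; congr (fine (mu _) *: _).
  apply/seteqP; split=> t [pt Dt]; split => //; first exact: CD.
  by apply: (sC _ ps); split.
under eq_integral do rewrite addr0.
move=> /le_trans; apply; apply: ge0_subset_integral => //.
exact: measurable_norm_simple_fun.
Qed.

(** The integrand itself need not be measurable, but it is almost everywhere a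
    limit of simple functions. *)
Lemma bochner_dist_ae_measurable f v s : is_bochner_integral mu D f v ->
  is_mu_simple mu D s ->
  exists a : T -> \bar R, [/\ measurable_fun D a, forall t, (0 <= a t)%E
    & {ae mu, forall t, D t -> `|f t - simple_fun s t|%:E = a t}].
Proof.
move=> [u [hu ucvg uint ulim]] hs.
exists (fun t => maxe 0%E
  (limn_esup (fun k => `|simple_fun (u k) t - simple_fun s t|%:E))).
split.
- apply: measurable_maxe; first exact: measurable_cst.
  apply: measurable_fun_limn_esup => k.
  under eq_fun do rewrite -simple_fun_sub.
  exact: measurable_norm_simple_fun (is_mu_simple_sub (hu k) hs).
- by move=> t; rewrite le_max lexx.
- apply: filterS ucvg => t ct /ct {}ct.
  have c : `|simple_fun (u k) t - simple_fun s t|%:E @[k --> \oo] -->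
      `|f t - simple_fun s t|%:E.
    apply/cvg_EFin; first by near=> k.
    by apply: cvg_norm; apply: cvgB => //; exact: cvg_cst.
  have [_ ->] := cvg_limn_einf_sup c.
  by rewrite max_r.
Unshelve. all: by end_near. Qed.

(** A Bochner integral is as well approximated by the integral of a simple
    function as the integrand is, in L^1-distance, by that function. *)
Lemma bochner_integral_dist f v s : is_bochner_integral mu D f v ->
  is_mu_simple mu D s ->
  (`|v - simple_integral mu D s|%:E
   <= \int[mu]_(t in D) `|f t - simple_fun s t|%:E)%E.
Proof.
move=> hf hs; have [u [hu ucvg uint ulim]] := hf.
pose I r := (\int[mu]_(t in D) `|f t - simple_fun r t|%:E)%E.
have triangle r r' : is_mu_simple mu D r -> is_mu_simple mu D r' ->
  (`|simple_integral mu D r - simple_integral mu D r'|%:E <= I r + I r')%E.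
  move=> hr hr'.
  have [a [ma a0 fa]] := bochner_dist_ae_measurable hf hr.
  have [b [mb b0 fb]] := bochner_dist_ae_measurable hf hr'.
  have -> : I r = (\int[mu]_(t in D) a t)%E.
    exact: ae_eq_integral_measurable_right.
  have -> : I r' = (\int[mu]_(t in D) b t)%E.
    exact: ae_eq_integral_measurable_right.
  rewrite -ge0_integralD// -simple_integral_sub.
  have hrr := is_mu_simple_sub hr hr'.
  apply: le_trans (norm_simple_integral_le hrr) _.
  apply: ae_le_integral_measurable_left => //.
  - exact: measurable_norm_simple_fun.
  - by move=> t _; exact: adde_ge0.
  - apply: filterS2 fa fb => t ta tb Dt.
    rewrite -(ta Dt) -(tb Dt) simple_fun_sub -EFinD lee_fin.
    by rewrite (distrC (f t) (simple_fun r t)); exact: ler_distD.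
have cv : (I (u k) + I s)%E @[k --> \oo] --> I s.
  rewrite -[X in _ --> X]add0e; apply: cvgeD; [|exact: uint|exact: cvg_cst].
  by rewrite fin_num_adde_defr.
have cw : `|simple_integral mu D (u k) - simple_integral mu D s|%:E @[k --> \oo]
    --> `|v - simple_integral mu D s|%:E.
  apply/cvg_EFin; first by near=> k.
  by apply: cvg_norm; apply: cvgB => //; exact: cvg_cst.
apply: lee_cvg_to cw cv _; near=> k.
by apply: triangle.
Unshelve. all: by end_near. Qed.

Lemma bochner_integral_unique f v w : is_bochner_integral mu D f v ->
  is_bochner_integral mu D f w -> v = w.
Proof.
move=> hv [u [hu ucvg uint ulim]].
have cw : `|v - simple_integral mu D (u k)|%:E @[k --> \oo] --> `|v - w|%:E.
  apply/cvg_EFin; first by near=> k.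
  by apply: cvg_norm; apply: cvgB => //; exact: cvg_cst.
have : (`|v - w|%:E <= 0)%E.
  apply: lee_cvg_to cw uint _; near=> k.
  exact: bochner_integral_dist.
by rewrite lee_fin normr_le0 subr_eq0 => /eqP.
Unshelve. all: by end_near. Qed.

Lemma bochner_integralE f v : is_bochner_integral mu D f v ->
  bochner_integral mu D f = v.
Proof.
move=> hf; rewrite /bochner_integral; case: xgetP => [w _ hw|/(_ v)//].
exact: bochner_integral_unique hw hf.
Qed.

Lemma is_bochner_integral_simple s : is_mu_simple mu D s ->
  is_bochner_integral mu D (simple_fun s) (simple_integral mu D s).
Proof.
move=> hs; exists (fun=> s); split => //.
- by apply: aeW => t _; exact: cvg_cst.
- under eq_fun do under eq_integral do rewrite subrr normr0.
  by rewrite integral0; exact: cvg_cst.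
- exact: cvg_cst.
Qed.

Lemma bochner_integral_simple s : is_mu_simple mu D s ->
  bochner_integral mu D (simple_fun s) = simple_integral mu D s.
Proof. by move=> /is_bochner_integral_simple /bochner_integralE. Qed.

Lemma simple_fun_norm_lty s : is_mu_simple mu D s ->
  (\int[mu]_(t in D) `|simple_fun s t|%:E < +oo)%E.
Proof.
elim: s => [_|p s IH hps].
  under eq_integral do rewrite /simple_fun big_nil normr0.
  by rewrite integral0.
have [mp pfin hs] := is_mu_simple_cons hps.
pose g t := (cst `|p.2|%:E \_ p.1) t.
have g0 t : D t -> (0 <= g t)%E by rewrite /g patchE; case: ifP; rewrite ?lee_fin.
have mg : measurable_fun D g.
  apply/measurable_restrict => //.
have ms := measurable_norm_simple_fun (A := D) hs.
apply: (@le_lt_trans _ _ (\int[mu]_(t in D) (g t + `|simple_fun s t|%:E))%E).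
  apply: le_integral_lower => t Dt //.
  rewrite simple_fun_cons /g patchE indicE; case: ifPn => _.
    by rewrite scale1r -EFinD lee_fin ler_normD.
  by rewrite scale0r !add0r.
rewrite ge0_integralD//.
apply: lte_add_pinfty; last exact: IH.
rewrite /g -integral_mkcondr integral_cst//; last exact: measurableI.
by rewrite setIC lte_mul_pinfty.
Qed.

Lemma bochner_norm_lty f v : is_bochner_integral mu D f v ->
  (\int[mu]_(t in D) `|f t|%:E < +oo)%E.
Proof.
move=> hf; have [u [hu ucvg uint ulim]] := hf.
have [k hk] : exists k,
    (\int[mu]_(t in D) `|f t - simple_fun (u k) t|%:E < +oo)%E.
  (* these integrals tend to 0, so they are not all infinite *)
  apply: contrapT => /forallNP H.
  have : (+oo <= 0 :> \bar R)%E; last by rewrite leye_eq.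
  apply: lee_cvg_to (cvg_cst _) uint _; near=> k.
  by have /negP := H k; rewrite ltey negbK => /eqP ->.
have [a [ma a0 fa]] := bochner_dist_ae_measurable hf (hu k).
have ms := measurable_norm_simple_fun (A := D) (hu k).
apply: (@le_lt_trans _ _ (\int[mu]_(t in D) (a t + `|simple_fun (u k) t|%:E))%E).
  apply: ae_le_integral_measurable_right => //.
  - exact: emeasurable_funD.
  - by move=> t _; rewrite adde_ge0.
  - apply: filterS fa => t ta Dt.
    rewrite -(ta Dt) -EFinD lee_fin.
    by rewrite -{1}(subrK (simple_fun (u k) t) (f t)) ler_normD.
rewrite ge0_integralD//; apply: lte_add_pinfty.
  rewrite (_ : (\int[mu]_(t in D) a t)%E
    = (\int[mu]_(t in D) `|f t - simple_fun (u k) t|%:E)%E)//.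
  by apply/esym; apply: ae_eq_integral_measurable_right.
exact: simple_fun_norm_lty.
Unshelve. all: by end_near. Qed.

End BochnerTheory.

(** * Sums over a countable type *)

Section DiscreteSum.
Context {R : realType} {T : choiceType}.
Implicit Types (q : T -> \bar R) (U : seq T).

Lemma esum_subset q (A B : set T) : A `<=` B -> (forall k, 0 <= q k)%E ->
  (\esum_(k in A) q k <= \esum_(k in B) q k)%E.
Proof.
move=> AB q0; rewrite [leRHS](esumID A); last by move=> k _; exact: q0.
have -> : B `&` A = A by exact/setIidPr.
by apply: leeDl; apply: esum_ge0 => k _; exact: q0.
Qed.

(** The remainders of a convergent series are small off large finite lists. *)
Lemma esum_tail_le q (e : R) : (forall k, 0 <= q k)%E ->
  (\esum_(k in [set: T]) q k < +oo)%E -> 0 < e ->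
  exists U0 : seq T, forall U, {subset U0 <= U} ->
    (\esum_(k in [set k | k \notin U]) q k <= e%:E)%E.
Proof.
move=> q0 qfin e0.
have qf : \esum_(k in [set: T]) q k \is a fin_num.
  by rewrite ge0_fin_numE// esum_ge0.
have [_ [A [Afin _] <-] Aq] := ub_ereal_sup_adherent e0 qf.
have [U0 AU0] : exists U0 : seq T, A = [set` U0] by exact/finite_seqP.
exists U0 => U U0U.
apply: (@le_trans _ _ (\esum_(k in ~` A) q k)%E).
  apply: esum_subset => // k /= kU; rewrite AU0 /= => kU0.
  by move/negP: kU; apply; exact: U0U.
move: Aq; rewrite -/(esum _ _) (esumID A)// !setTI esum_fset//.
set a := (\sum_(i \in A) q i)%E; set b := esum _ _ => ab.
have b0 : (0 <= b)%E by exact: esum_ge0.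
have : a \is a fin_num.
  rewrite ge0_fin_numE ?fsume_ge0// /a -esum_fset//.
  by apply: le_lt_trans qfin; exact: esum_subset.
have : b \is a fin_num.
  by rewrite ge0_fin_numE//; apply: le_lt_trans qfin; exact: esum_subset.
move: a b b0 ab {qf qfin} => [a||] [b||] //= _; rewrite -!EFinD !lte_fin lee_fin.
lra.
Qed.

Lemma sum_seq_le_esum q (A : set T) U : (forall k, 0 <= q k)%E -> uniq U ->
  (forall k, k \in U -> A k) ->
  (\sum_(k <- U) q k <= \esum_(k in A) q k)%E.
Proof.
move=> q0 uU UA; apply: esum_ge; exists [set` U].
  by split; [exact: finite_seq|move=> k /UA].
by rewrite -fsbig_seq.
Qed.

Lemma esum_comp_inj_le q (e : T -> T) : (forall k, 0 <= q k)%E -> injective e ->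
  (\esum_(k in [set: T]) q (e k) <= \esum_(k in [set: T]) q k)%E.
Proof.
move=> q0 ie; rewrite -(esum_image setT e q).
  exact: esum_subset.
by move=> x y _ _; exact: ie.
Qed.

Lemma esum_scale_lty q (C : R) : (forall k, 0 <= q k)%E -> 0 <= C ->
  (\esum_(k in [set: T]) q k < +oo)%E ->
  (\esum_(k in [set: T]) (C%:E * q k) < +oo)%E.
Proof.
move=> q0 C0 qfin.
apply: (@le_lt_trans _ _ (C%:E * \esum_(k in [set: T]) q k)%E).
  apply: ge_ereal_sup => _ [A [Afin AT] <-].
  rewrite -ge0_mule_fsumr//; apply: lee_wpmul2l; first by rewrite lee_fin.
  by apply: esum_ge; exists A.
by rewrite lte_mul_pinfty// lee_fin.
Qed.

End DiscreteSum.

(** * Bochner integrals of discrete random variables *)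

(** [f] is almost surely a function [h] of the discrete random variable [K], and
    [p] is the law of [K]. *)
Section DiscreteBochner.
Context {d : measure_display} {Omega : measurableType d} {R : realType}.
Variable P : probability Omega R.
Context {T : countType}.
Variable K : Omega -> T.
Hypothesis mK : forall k, measurable (K @^-1` [set k]).
Context {X : completeNormedModType R}.

Lemma measurable_discrete (phi : T -> \bar R) (D : set Omega) :
  measurable_fun D (phi \o K).
Proof.
apply: (@measurable_funS _ _ _ _ setT) => // _ Y mY; rewrite setTI.
rewrite [X in measurable X](_ : _ = \bigcup_k
    (if `[< Y (phi k) >] then K @^-1` [set k] else set0)).
  by apply: countable_bigcupT_measurable => // k; case: ifP.
apply/seteqP; split=> [w Yw|w [k _]].
  by exists (K w) => //; rewrite asboolT.
by case: ifPn => // /asboolP Yk KwE; rewrite /preimage /= KwE.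
Qed.

Lemma ge0_integral_discrete (phi : T -> \bar R) : (forall k, 0 <= phi k)%E ->
  (\int[P]_w phi (K w) = \esum_(k in [set: T]) (phi k * P (K @^-1` [set k])))%E.
Proof.
move=> phi0.
(* the fibers of [K], indexed by their codes in [nat] and empty at the
   integers that are no code *)
pose F i := K @^-1` [set k | pickle k = i].
have FE k : F (pickle k) = K @^-1` [set k].
  apply/seteqP; split => w; first by move/(pcan_inj (@pickleK T)).
  by rewrite /F /= => ->.
have F0 i : ~ (exists k : T, pickle k = i) -> F i = set0.
  by move=> ni; apply/seteqP; split=> w //= Ki; apply: ni; exists (K w).
have mF i : measurable (F i).
  have [[k <-]|/F0 ->] := pselect (exists k : T, pickle k = i); last by [].
  by rewrite FE.
have -> : [set: Omega] = \bigcup_i F i.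
  by apply/seteqP; split => w // _; exists (pickle (K w)).
rewrite ge0_integral_bigcup//.
- rewrite nneseries_esumT; last by move=> i; apply: integral_ge0 => w _; exact: phi0.
  rewrite (esumID (range (@pickle T))); last by move=> i _; apply: integral_ge0.
  rewrite !setTI [X in (_ + X)%E](_ : _ = 0%E) ?adde0; last first.
    apply: esum1 => i /= ni; rewrite F0 ?integral_set0//.
    by move=> [k ki]; apply: ni; exists k.
  rewrite esum_image; last by move=> x y _ _; exact: (pcan_inj (@pickleK T)).
  apply: eq_esum => k _; rewrite FE.
  rewrite (eq_integral (cst (phi k))); last by move=> w; rewrite inE => /= ->.
  by rewrite integral_cst.
- exact: (@measurable_discrete phi).
- by move=> i j _ _ [w [/= <- <-]].
Qed.

Variables (h : T -> X) (f : Omega -> X).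
Hypothesis fh : {ae P, forall w, f w = h (K w)}.

Let p k := fine (P (K @^-1` [set k])).

Lemma bochner_discrete_summable v : is_bochner_integral P setT f v ->
  (\esum_(k in [set: T]) (p k * `|h k|)%:E < +oo)%E.
Proof.
move=> /(bochner_norm_lty measurableT).
rewrite (@ae_eq_integral_measurable_right _ _ _ _ _ _ (fun w => `|h (K w)|%:E))//.
- rewrite (ge0_integral_discrete (phi := fun k => `|h k|%:E))//.
  move=> H; apply: le_lt_trans H; apply: le_esum => k _.
  by rewrite EFinM muleC /p fineK// fin_num_measure.
- exact: (@measurable_discrete (fun k => `|h k|%:E)).
- by apply: filterS fh => w ->.
Qed.

(** The Bochner integral of [f] is the sum of the series of [p k *: h k], with the
    expected bound on the remainders. *)
Lemma bochner_discrete_tail v (U : seq T) : is_bochner_integral P setT f v ->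
  uniq U ->
  (`|v - \sum_(k <- U) p k *: h k|%:E
    <= \esum_(k in [set k | k \notin U]) (p k * `|h k|)%:E)%E.
Proof.
move=> hf uU; pose s := [seq (K @^-1` [set k], h k) | k <- U].
have hs : is_mu_simple P setT s.
  move=> q /mapP[k kU ->] /=; split; first exact: mK.
  by rewrite setIT; apply: le_lt_trans (probability_le1 _ _) _; rewrite ?ltry.
have -> : \sum_(k <- U) p k *: h k = simple_integral P setT s.
  by rewrite /simple_integral big_map; apply: eq_bigr => k _ /=; rewrite setIT.
have sE w : simple_fun s w = if K w \in U then h (K w) else 0.
  rewrite /simple_fun big_map /=; case: ifPn => KU.
    rewrite (bigD1_seq (K w))//= indicE mem_set// scale1r big1 ?addr0// => k kK.
    by rewrite indicE memNset ?scale0r// => /= KwE; rewrite KwE eqxx in kK.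
  rewrite big_seq big1// => k kU.
  by rewrite indicE memNset ?scale0r// => /= KwE; rewrite KwE kU in KU.
apply: le_trans (bochner_integral_dist measurableT hf hs) _.
pose phi k : \bar R := if k \in U then 0%E else `|h k|%:E.
rewrite (@ae_eq_integral_measurable_right _ _ _ _ _ _ (phi \o K))//.
- rewrite (ge0_integral_discrete (phi := phi)); last first.
    by move=> k; rewrite /phi; case: ifP; rewrite ?lee_fin.
  rewrite [leRHS]esum_mkcond; apply: le_esum => k _.
  rewrite /phi; case: ifPn => kU; first rewrite mul0e.
    by case: ifP; rewrite // lee_fin mulr_ge0// fine_ge0.
  rewrite mem_set// EFinM muleC /p fineK//.
  exact: fin_num_measure.
- exact: measurable_discrete.
- by move=> w _; rewrite /phi /=; case: ifP.
- apply: filterS fh => w -> _; rewrite sE /phi /=; case: ifP => _.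
    by rewrite subrr normr0.
  by rewrite subr0.
Qed.

End DiscreteBochner.

(** * Summation by parts on the lattice *)

(** A natural number other than [L] is bounded by a multiple of its distance to
    [L], because the natural numbers do not accumulate at [L]. *)
Lemma nat_gap (R : realType) (L : R) : 0 <= L ->
  exists2 C : R, 0 <= C & forall c : nat, c%:R != L -> c%:R <= C * `|c%:R - L|.
Proof.
move=> L0.
have [e e0 He] : exists2 e : R, 0 < e &
    forall c : nat, c%:R != L -> e <= `|c%:R - L|.
  have /andP[mL Lm] := truncn_itv L0; set m := Num.truncn L in mL Lm.
  have [mE|mNE] := eqVneq (m%:R : R) L.
    exists 1 => // c; rewrite -mE eqr_nat => cm.
    have : (c < m)%N || (m < c)%N by rewrite -neq_ltn.
    move=> /orP[]; rewrite -(ler_nat R) -natr1 => h.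
      by rewrite distrC ger0_norm; lra.
    by rewrite ger0_norm; lra.
  exists (Num.min (L - m%:R) (m.+1%:R - L)).
    by rewrite lt_min !subr_gt0 Lm lt_neqAle mNE mL.
  move=> c _; rewrite ge_min; have [cm|cm] := leqP c m; apply/orP; [left|right].
    move: cm; rewrite -(ler_nat R) => cm.
    by rewrite distrC ger0_norm; lra.
  move: cm Lm; rewrite -(ler_nat R) => cm Lm.
  by rewrite ger0_norm; lra.
exists (1 + L / e) => [|c cL].
  by rewrite addr_ge0// divr_ge0// ltW.
rewrite mulrDl mul1r -{1}(subrK L c%:R); apply: lerD; first exact: ler_norm.
rewrite mulrAC -mulrA ler_peMr// ler_pdivlMr// mul1r; exact: He.
Qed.

Section Lattice.
Context {n : nat}.
Notation T := {ffun 'I_n -> nat}.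

(** The lattice point [k + e_j]. *)
Definition up (j : 'I_n) (k : T) : T := [ffun i => (k i + (i == j))%N].

Lemma up_inj j : injective (up j).
Proof.
move=> k l /ffunP kl; apply/ffunP => i.
by have := kl i; rewrite !ffunE => /addIn.
Qed.

(** The lattice points whose coordinates are all less than [m]. *)
Definition box (m : nat) : seq T :=
  [seq [ffun i => u i : nat] | u : {ffun 'I_n -> 'I_m}].

Lemma mem_box m k : (k \in box m) = [forall i, (k i < m)%N].
Proof.
apply/mapP/forallP => [[u _ -> i]|km]; first by rewrite ffunE.
exists [ffun i => Ordinal (km i)]; first by rewrite mem_enum.
by apply/ffunP => i; rewrite !ffunE.
Qed.

Lemma box_uniq m : uniq (box m).
Proof.
rewrite map_inj_uniq ?enum_uniq// => u v /ffunP uv; apply/ffunP => i.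
by apply: val_inj; have := uv i; rewrite !ffunE.
Qed.

Lemma sub_box (U : seq T) : exists m, {subset U <= box m}.
Proof.
exists (\max_(k <- U) \max_i (k i)).+1 => k kU; rewrite mem_box.
apply/forallP => i; rewrite ltnS.
by apply: leq_trans (leq_bigmax_seq _ kU _) => //; exact: leq_bigmax.
Qed.

Context {R : realType} {X : normedModType R}.

(** Shifting a box along [e_j] drops only points with [k_j = 0], where [H]
    vanishes, and the points gained lie outside the box. *)
Lemma box_shift (H : T -> X) (j : 'I_n) (m : nat) :
  (forall k : T, k j = 0%N -> H k = 0) ->
  (`|\sum_(k <- box m) H (up j k) - \sum_(k <- box m) H k|%:E
   <= \esum_(k in [set k | k \notin box m]) `|H k|%:E)%E.
Proof.
move=> H0; pose V := map (up j) (box m).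
have uV : uniq V by rewrite map_inj_uniq ?box_uniq//; exact: up_inj.
have -> : \sum_(k <- box m) H (up j k) = \sum_(k <- V) H k by rewrite [RHS]big_map.
rewrite (bigID (fun k => k \in box m))/= [X in _ - X](bigID (fun k => k \in V))/=.
rewrite [X in _ - (_ + X)]big1_seq ?addr0; last first.
  move=> k /andP[kV kU]; apply: H0; apply/eqP; apply: contraNT kV => kj.
  have kE : k = up j [ffun i => (k i - (i == j))%N].
    apply/ffunP => i; rewrite !ffunE; case: eqP => [->|]; last by rewrite subn0 addn0.
    by rewrite subnK// lt0n.
  rewrite kE map_f// mem_box; apply/forallP => i; rewrite ffunE.
  by apply: leq_ltn_trans (leq_subr _ _) _; move: kU; rewrite mem_box => /forallP.
rewrite -big_filter -[X in _ - X]big_filter.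
rewrite (perm_big [seq k <- box m | k \in V]); last first.
  apply: uniq_perm; rewrite ?filter_uniq ?box_uniq//.
  by move=> k; rewrite !mem_filter andbC.
rewrite addrAC subrr add0r -big_filter.
apply: (@le_trans _ _ (\sum_(k <- [seq k <- V | k \notin box m]) `|H k|%:E)%E).
  by rewrite sumEFin lee_fin ler_norm_sum.
apply: sum_seq_le_esum => //; first by rewrite filter_uniq.
by move=> k; rewrite mem_filter => /andP[].
Qed.

(** [p] stands for the law of independent Poisson variables with parameters
    [lam j], of which only the recurrence [mecke] is used. *)
Variables (lam : 'I_n -> R) (p : T -> R) (S : {set 'I_n}) (g : T -> X).
Hypothesis lam0 : forall j, 0 <= lam j.
Hypothesis p0 : forall k, 0 <= p k.
Hypothesis mecke : forall j (k : T), lam j * p k = (k j).+1%:R * p (up j k).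

(** The number of points in the union of the sets of [S], for a configuration
    with [k j] points in the [j]-th set. *)
Definition total (k : T) : nat := (\sum_(j in S) k j)%N.

(** The mean of [total]. *)
Definition intensity : R := \sum_(j in S) lam j.

(** The integral, over the union of the sets of [S], of the increments of [g]
    when one point is added. *)
Definition gradient (k : T) : X := \sum_(j in S) lam j *: (g (up j k) - g k).

(** The product of [g] with the centred number of points in that union. *)
Definition centred (k : T) : X := ((total k)%:R - intensity) *: g k.

Lemma total_up j k : j \in S -> total (up j k) = (total k).+1.
Proof.
move=> jS; rewrite /total (bigD1 j)//= [in RHS](bigD1 j)//= ffunE eqxx addn1 addSn.
by congr (_ + _).+1; apply: eq_bigr => i /andP[_ /negbTE ij]; rewrite ffunE ij addn0.
Qed.

Lemma coord_le_total (k : T) j : j \in S -> (k j <= total k)%N.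
Proof. by move=> jS; rewrite /total (bigD1 j)//= leq_addr. Qed.

Hypothesis sum_gradient :
  (\esum_(k in [set: T]) (p k * `|gradient k|)%:E < +oo)%E.
Hypothesis sum_centred :
  (\esum_(k in [set: T]) (p k * `|centred k|)%:E < +oo)%E.

(** Summability of [centred] bounds [g] off the layer [total k = intensity]; on
    that layer [g] is recovered from [gradient] and from the values of [g] at
    the points [up j k], which lie off the layer. *)
Lemma total_summable :
  (\esum_(k in [set: T]) ((total k)%:R * p k * `|g k|)%:E < +oo)%E.
Proof.
have L0 : 0 <= intensity by exact: sumr_ge0.
have [C C0 HC] := nat_gap L0.
pose r k := C * (p k * `|centred k|).
have r0 k : 0 <= r k by rewrite !mulr_ge0.
have off k : (total k)%:R != intensity -> (total k)%:R * p k * `|g k| <= r k.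
  move=> /HC h; rewrite /r /centred normrZ.
  rewrite [leRHS](_ : _ = C * `|(total k)%:R - intensity| * (p k * `|g k|)); last by ring.
  by rewrite -mulrA; apply: ler_wpM2r => //; exact: mulr_ge0.
have bound k : (total k)%:R * p k * `|g k|
    <= r k + p k * `|gradient k| + \sum_(j in S) r (up j k).
  have [tL|tL] := eqVneq (total k)%:R intensity; last first.
    rewrite -addrA; apply: le_trans (off _ tL) _; rewrite lerDl.
    by rewrite addr_ge0 ?mulr_ge0// sumr_ge0.
  have up_off j : j \in S -> (total (up j k))%:R != intensity.
    by move=> jS; rewrite -tL total_up// eqr_nat eqn_leq ltnn.
  have gE : intensity *: g k = \sum_(j in S) lam j *: g (up j k) - gradient k.
    rewrite /gradient -sumrB scaler_suml; apply: eq_bigr => j _.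
    by rewrite -scalerBr opprB addrC subrK.
  have -> : (total k)%:R * p k * `|g k| = p k * `|intensity *: g k|.
    by rewrite normrZ ger0_norm// tL mulrAC mulrC mulrA.
  have : p k * `|intensity *: g k|
      <= \sum_(j in S) p k * lam j * `|g (up j k)| + p k * `|gradient k|.
    rewrite gE.
    apply: (@le_trans _ _
      (p k * (\sum_(j in S) `|lam j *: g (up j k)| + `|gradient k|))).
      apply: ler_wpM2l => //; apply: le_trans (ler_normB _ _) _.
      by rewrite lerD2r ler_norm_sum.
    rewrite mulrDr lerD2r mulr_sumr le_eqVlt; apply/orP; left; apply/eqP.
    by apply: eq_bigr => j _; rewrite normrZ ger0_norm// mulrA.
  have : \sum_(j in S) p k * lam j * `|g (up j k)| <= \sum_(j in S) r (up j k).
    apply: ler_sum => j jS; apply: le_trans (off _ (up_off _ jS)).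
    rewrite (mulrC (p k)) mecke ler_wpM2r// ler_wpM2r// ler_nat total_up// ltnS.
    exact: coord_le_total.
  have := r0 k; lra.
apply: (@le_lt_trans _ _ (\esum_(k in [set: T]) (r k + p k * `|gradient k|
    + \sum_(j in S) r (up j k))%:E)%E).
  by apply: le_esum => k _; rewrite lee_fin.
have rfin : (\esum_(k in [set: T]) (r k)%:E < +oo)%E.
  under eq_esum do rewrite /r EFinM.
  apply: esum_scale_lty => // k; by rewrite lee_fin mulr_ge0.
have pg0 k : 0 <= p k * `|gradient k| by exact: mulr_ge0.
under eq_esum do rewrite !EFinD.
rewrite esumD/=; last 2 first.
- by move=> k _; rewrite -EFinD lee_fin addr_ge0.
- by move=> k _; rewrite lee_fin sumr_ge0.
rewrite esumD//; last 2 first.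
- by move=> k _; rewrite lee_fin.
- by move=> k _; rewrite lee_fin.
apply: lte_add_pinfty; first exact: lte_add_pinfty.
under eq_esum do rewrite -sumEFin.
rewrite esum_sum; last by move=> k j _ _; rewrite lee_fin.
apply: lte_sum_pinfty => j _; apply: le_lt_trans rfin.
apply: (esum_comp_inj_le (q := fun k => (r k)%:E)); last exact: up_inj.
by move=> k; rewrite lee_fin.
Qed.

(** A summable function whose remainders bound all the errors made on a box. *)
Let majorant (k : T) : R := p k * `|gradient k| + p k * `|centred k|
  + \sum_(j in S) (k j)%:R * p k * `|g k|.

Let majorant_ge0 k : 0 <= majorant k.
Proof. by rewrite !addr_ge0 ?mulr_ge0// sumr_ge0// => j _; rewrite !mulr_ge0. Qed.

Let majorant_tail (A : set T) : (\esum_(k in A) (majorant k)%:E =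
  \esum_(k in A) (p k * `|gradient k|)%:E + \esum_(k in A) (p k * `|centred k|)%:E
  + \sum_(j in S) \esum_(k in A) ((k j)%:R * p k * `|g k|)%:E)%E.
Proof.
under eq_esum do rewrite !EFinD.
rewrite esumD/=; last 2 first.
- by move=> k _; rewrite -EFinD lee_fin addr_ge0// mulr_ge0.
- by move=> k _; rewrite lee_fin sumr_ge0// => j _; rewrite !mulr_ge0.
rewrite esumD//; last 2 first.
- by move=> k _; rewrite lee_fin mulr_ge0.
- by move=> k _; rewrite lee_fin mulr_ge0.
congr (_ + _)%E; under eq_esum do rewrite -sumEFin.
by rewrite esum_sum// => k j _ _; rewrite lee_fin !mulr_ge0.
Qed.

Let majorant_summable : (\esum_(k in [set: T]) (majorant k)%:E < +oo)%E.
Proof.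
rewrite majorant_tail; apply: lte_add_pinfty; first exact: lte_add_pinfty.
apply: lte_sum_pinfty => j jS; apply: le_lt_trans total_summable.
apply: le_esum => k _; rewrite lee_fin !ler_wpM2r// ler_nat.
exact: coord_le_total.
Qed.

(** The Mecke identity: [gradient] and [centred] have the same sum against [p]. *)
Lemma mecke_sum v1 v2 :
  (forall U : seq T, uniq U ->
     (`|v1 - \sum_(k <- U) p k *: gradient k|%:E
      <= \esum_(k in [set k | k \notin U]) (p k * `|gradient k|)%:E)%E) ->
  (forall U : seq T, uniq U ->
     (`|v2 - \sum_(k <- U) p k *: centred k|%:E
      <= \esum_(k in [set k | k \notin U]) (p k * `|centred k|)%:E)%E) ->
  v1 = v2.
Proof.
move=> h1 h2.
have boxes m : (`|v1 - v2|%:E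
    <= \esum_(k in [set k | k \notin box m]) (majorant k)%:E)%E.
  set U := box m; pose H (j : 'I_n) (k : T) := ((k j)%:R * p k) *: g k.
  have diff : \sum_(k <- U) p k *: gradient k - \sum_(k <- U) p k *: centred k
      = \sum_(j in S) (\sum_(k <- U) H j (up j k) - \sum_(k <- U) H j k).
    rewrite -sumrB.
    under [RHS]eq_bigr do rewrite -sumrB.
    rewrite exchange_big/=; apply: eq_bigr => k _.
    rewrite /gradient /centred /total /intensity natr_sum -sumrB scaler_suml.
    rewrite !scaler_sumr -sumrB; apply: eq_bigr => j _.
    (* the recurrence of [p] turns the weights of [g (up j k)] into values of [H] *)
    have -> : H j (up j k) = (lam j * p k) *: g (up j k).
      by rewrite /H mecke ffunE eqxx addn1.
    rewrite /H !scalerA scalerBr -addrA -opprD -scalerDl (mulrC (p k) (lam j)).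
    by congr (_ - _ *: _); ring.
  rewrite majorant_tail.
  apply: (@le_trans _ _ (`|v1 - \sum_(k <- U) p k *: gradient k|%:E
    + `|v2 - \sum_(k <- U) p k *: centred k|%:E
    + \sum_(j in S) `|\sum_(k <- U) H j (up j k) - \sum_(k <- U) H j k|%:E)%E).
    rewrite sumEFin -!EFinD lee_fin.
    apply: le_trans (_ : _ <= `|v1 - \sum_(k <- U) p k *: gradient k|
       + `|v2 - \sum_(k <- U) p k *: centred k|
       + `|\sum_(k <- U) p k *: gradient k - \sum_(k <- U) p k *: centred k|) _.
      set a := \sum_(k <- U) p k *: gradient k.
      set b := \sum_(k <- U) p k *: centred k.
      rewrite -addrA (addrC `|v2 - b|) addrA.
      apply: le_trans (ler_distD b _ _) _; rewrite (distrC b) lerD2r.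
      exact: ler_distD.
    by rewrite lerD2l diff ler_norm_sum.
  apply: leeD; first by apply: leeD; [apply: h1|apply: h2]; exact: box_uniq.
  apply: lee_sum => j jS.
  apply: le_trans (box_shift _ _) _.
    by move=> k kj; rewrite /H kj mul0r scale0r.
  by apply: le_esum => k _; rewrite /H normrZ ger0_norm// mulr_ge0.
apply/eqP; rewrite -subr_eq0 -normr_le0; apply/ler_addgt0Pr => e e0; rewrite add0r.
have [|U0 hU0] := esum_tail_le _ majorant_summable e0.
  by move=> k; rewrite lee_fin.
have [m U0m] := sub_box U0.
by rewrite -lee_fin; apply: le_trans (boxes m) (hU0 _ U0m).
Qed.

End Lattice.

(** * Poisson random measures on a finite disjoint family *)

Section Mass.
Context {R : realType}.
Implicit Type r : R.

Lemma poisson_mass_ge0 r k : 0 <= r -> 0 <= poisson_mass r k.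
Proof. by move=> r0; rewrite /poisson_mass !mulr_ge0 ?expR_ge0 ?exprn_ge0. Qed.

Lemma poisson_mass_succ r k :
  r * poisson_mass r k = k.+1%:R * poisson_mass r k.+1.
Proof.
rewrite /poisson_mass factS natrM exprS.
have k0 : k.+1%:R != 0 :> R by rewrite pnatr_eq0.
have f0 : k`!%:R != 0 :> R by rewrite pnatr_eq0 -lt0n fact_gt0.
by move: k.+1%:R k`!%:R k0 f0 => c f c0 f0; field; rewrite c0 f0.
Qed.

Lemma poisson_mass_sum r : 0 <= r -> (\sum_(k <oo) (poisson_mass r k)%:E = 1)%E.
Proof.
move=> r0.
rewrite [RHS](_ : _ = (expR (- r))%:E * (expR r)%:E)%E; last first.
  by rewrite -EFinM expRN mulVf ?gt_eqF ?expR_gt0.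
under eq_eseriesr do rewrite /poisson_mass -mulrA EFinM.
rewrite nneseriesZl/=; last by move=> k _; rewrite lee_fin divr_ge0// exprn_ge0.
congr (_ * _)%E; rewrite expRE -EFin_lim; last first.
  rewrite /pseries/=; under eq_fun do rewrite mulrC.
  exact: is_cvg_series_exp_coeff.
apply/congr_lim/funext => m /=; rewrite /pseries/= /series/= -sumEFin//.
by under eq_bigr do rewrite mulrC.
Qed.

End Mass.

Lemma ae_forall_fin {d : measure_display} {T : measurableType d} {R : realType}
    (mu : {measure set T -> \bar R}) (I : finType) (Q : I -> T -> Prop) :
  (forall i, {ae mu, forall t, Q i t}) -> {ae mu, forall t, forall i, Q i t}.
Proof.
move=> aeQ.
have : {ae mu, forall t, forall m : nat, forall i : I, pickle i = m -> Q i t}.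
  apply: ae_foralln => m.
  have [[i im]|ni] := pselect (exists i : I, pickle i = m).
    apply: filterS (aeQ i) => t Qt i' im'.
    by have -> : i' = i by apply: (pcan_inj (@pickleK I)); rewrite im im'.
  by apply: aeW => t i im; exfalso; apply: ni; exists i.
by apply: filterS => t Qt i; exact: Qt.
Qed.

Lemma ae_measure_eq {d : measure_display} {T : measurableType d} {R : realType}
    (mu : {measure set T -> \bar R}) (A B : set T) :
  measurable A -> measurable B -> {ae mu, forall t, A t <-> B t} -> mu A = mu B.
Proof.
move=> mA mB [C [mC C0 sC]].
have sub A' B' : measurable A' -> measurable B' ->
    (forall t, ~ C t -> A' t -> B' t) -> (mu A' <= mu B')%E.
  move=> mA' mB' AB.
  apply: (@le_trans _ _ (mu (B' `|` C))).
    apply: le_measure; rewrite ?inE//; first exact: measurableU.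
    by move=> t A't; have [|nC] := pselect (C t); [right|left; exact: AB].
  apply: le_trans (measureU2 _ _ _) _ => //.
  by rewrite [X in (_ + X)%E](_ : _ = 0%E) ?adde0.
have ACB t : ~ C t -> (A t <-> B t).
  by move=> nC; apply: contrapT => h; apply: nC; exact: sC.
by apply/eqP; rewrite eq_le !sub// => t /ACB[].
Qed.

Lemma bigsetUE {T : Type} (I : finType) (s : {set I}) (A : I -> set T) :
  \big[setU/set0]_(j in s) A j = [set t | exists2 j, j \in s & A j t].
Proof.
rewrite -bigcup_seq_cond; apply/seteqP; split=> [t [j /andP[_ js] At]|t [j js At]].
  by exists j.
by exists j => //=; rewrite js mem_index_enum.
Qed.

(** Every finite family of sets of finite measure is made of unions of sets of
    a disjoint one. *)
Lemma disjoint_refinement {d : measure_display} {E : measurableType d}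
    {R : realType} (mu : {measure set E -> \bar R}) (I : finType)
    (B : I -> set E) : (forall i, finite_measure_sets mu (B i)) ->
  exists (n : nat) (A : 'I_n -> set E) (sigma : I -> {set 'I_n}),
    [/\ (0 < n)%N, forall j, finite_measure_sets mu (A j),
      trivIset [set: 'I_n] A
      & forall i, B i = \big[setU/set0]_(j in sigma i) A j].
Proof.
move=> hB.
(* the atoms of the finite Boolean algebra generated by the sets, except for
   the one lying outside all of them, which may have infinite measure *)
pose A (j : 'I_#|{set I}|) : set E :=
  [set e | (exists i, B i e) /\ forall i, (B i e <-> i \in enum_val j)].
have tA : trivIset setT A.
  move=> j j' _ _ [e [[_ h] [_ h']]]; apply: enum_val_inj; apply/setP => i.
  by apply/idP/idP => [/h /h'|/h' /h].
have mA j : measurable (A j).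
  rewrite [X in measurable X](_ : _ = (\bigcup_i B i) `&`
      \bigcap_i (if i \in enum_val j then B i else ~` B i)); last first.
    apply/seteqP; split=> e.
      move=> [[i Bi] h]; split; first by exists i.
      by move=> k _; case: ifPn => [/h//|ij Bk]; move/negP: ij; apply; apply/h.
    move=> [[i _ Bi] h]; split; first by exists i.
    by move=> k; have := h k Logic.I; case: ifPn.
  apply: measurableI; last rewrite -(setCK (\bigcap_i _)) setC_bigcap;
    [|apply: measurableC]; apply: countable_bigcupT_measurable => [|i].
  - exact: countableP.
  - by have [] := hB i.
  - exact: countableP.
  - by apply: measurableC; case: ifP => _; [|apply: measurableC]; have [] := hB i.
exists #|{set I}|, A,
  (fun i => [set j : 'I_#|{set I}| | i \in (enum_val j : {set I})]%SET).
split => //.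
- by apply/card_gt0P; exists [set: I]%SET.
- move=> j; split => //; have [[i ij]|ni] := pselect (exists i, i \in enum_val j).
    have [mB Bfin] := hB i.
    apply: (measure_sub_lty (mA j) mB _ Bfin) => e [_ h]; exact/h.
  have -> : A j = set0.
    apply/seteqP; split=> // e [[i Bi] h]; apply: ni; exists i; exact/h.
  by rewrite measure0.
- move=> i; rewrite bigsetUE; apply/seteqP; split=> [e Be|e [j + [_ h]]].
    exists (enum_rank [set k | `[< B k e >]]%SET).
      by rewrite inE enum_rankK inE; exact/asboolP.
    split; first by exists i.
    move=> k; rewrite enum_rankK inE; split; first by move=> Bk; exact/asboolP.
    by move=> /asboolP.
  by rewrite inE; move=> ij; apply/h.
Qed.

Section Prm.
Context {dO dE : measure_display} {Omega : measurableType dO}.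
Context {E : measurableType dE} {R : realType}.
Variables (P : probability Omega R) (mu : {measure set E -> \bar R}).
Variable N : Omega -> {measure set E -> \bar R}.
Hypothesis hN : poisson_random_measure P mu N.

Lemma prm_level_measurable B y : measurable B -> measurable [set w | N w B = y].
Proof.
move=> mB; have [_ mN _ _ _] := hN.
have := mN B mB measurableT [set y] (emeasurable_set1 _).
by rewrite setTI.
Qed.

(** The Poisson masses add up to 1, which leaves no mass at infinity. *)
Lemma prm_ae_nat B : finite_measure_sets mu B ->
  {ae P, forall w, exists k : nat, N w B = k%:R%:E}.
Proof.
move=> [mB Bfin]; have [_ mN law _ _] := hN.
pose U := \bigcup_k [set w | N w B = k%:R%:E].
have mU : measurable U by apply: bigcupT_measurable => k; exact: prm_level_measurable.
have PU : P U = 1%E.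
  rewrite measure_bigcup; last 2 first.
  - by move=> k _; exact: prm_level_measurable.
  - move=> i j _ _ [w [/= -> []]] /eqP; rewrite eqr_nat => /eqP ->; done.
  rewrite -(@poisson_mass_sum R (fine (mu B))) ?fine_ge0//.
  rewrite (@eq_eseriesl _ _ xpredT); last by move=> k; rewrite in_setT.
  by apply: eq_eseriesr => k _; exact: law.
exists (~` U); split => //; first exact: measurableC.
  by rewrite probability_setC// PU subee.
by apply: subsetC => w [k _ Nk]; exists k.
Qed.

Lemma counts_eq n (A : 'I_n -> set E) w j (k : nat) :
  N w (A j) = k%:R%:E -> counts N A w j = k.
Proof. by rewrite /counts => ->; rewrite /= natrK. Qed.

Lemma counts_level_measurable n (A : 'I_n -> set E) j (k : nat) :
  measurable (A j) -> measurable [set w | counts N A w j = k].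
Proof.
move=> mA; have [dich _ _ _ _] := hN.
rewrite [X in measurable X](_ : _ = [set w | N w (A j) = k%:R%:E] `|`
   (if k == 0%N then [set w | N w (A j) = +oo%E] else set0)).
  apply: measurableU; first exact: prm_level_measurable.
  by case: ifP => // _; exact: prm_level_measurable.
have inf w : N w (A j) = +oo%E -> counts N A w j = 0%N.
  by rewrite /counts => -> /=; rewrite (_ : 0 = 0%:R)// natrK.
apply/seteqP; split=> w /=.
  have [Noo|[l Nl]] := dich w (A j) mA.
    by move=> /esym kE; right; rewrite kE inf// eqxx.
  by move=> <-; left; rewrite (counts_eq Nl).
by case; [exact: counts_eq|case: eqP => // -> /inf].
Qed.

(** Almost surely all the masses involved are finite, and the points in a union
    of disjoint sets are counted set by set. *)
Lemma prm_counts_additive (I : finType) (B : I -> set E) n (A : 'I_n -> set E)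
    (sigma : I -> {set 'I_n}) : (forall j, finite_measure_sets mu (A j)) ->
  trivIset [set: 'I_n] A -> (forall i, B i = \big[setU/set0]_(j in sigma i) A j) ->
  {ae P, forall w, forall i,
     N w (B i) = (\sum_(j in sigma i) counts N A w j)%N%:R%:E}.
Proof.
move=> fA tA BA.
have := @ae_forall_fin _ _ _ P _ (fun j w => exists k : nat, N w (A j) = k%:R%:E)
  (fun j => prm_ae_nat (fA j)).
apply: filterS => w Nnat i.
rewrite BA measure_bigsetU_ord//; last by move=> j; have [] := fA j.
rewrite natr_sum -sumEFin; apply: eq_bigr => j _.
by have [k Nk] := Nnat j; rewrite (counts_eq Nk).
Qed.

Section Law.
Variables (n : nat) (A : 'I_n -> set E).
Hypothesis fA : forall j, finite_measure_sets mu (A j).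
Hypothesis tA : trivIset [set: 'I_n] A.

(** The counts of a family, as an element of a countable type. *)
Definition counting (w : Omega) : {ffun 'I_n -> nat} := [ffun j => counts N A w j].

(** The law of [counting]: a product of Poisson laws. *)
Definition counts_mass (k : {ffun 'I_n -> nat}) : R :=
  \prod_(j < n) poisson_mass (fine (mu (A j))) (k j).

Let level k : counting @^-1` [set k] = \bigcap_j [set w | counts N A w j = k j].
Proof.
apply/seteqP; split=> [w <- j _|w h]; first by rewrite /= ffunE.
by apply/ffunP => j; rewrite ffunE; exact: h.
Qed.

Lemma counting_measurable k : measurable (counting @^-1` [set k]).
Proof.
rewrite level; apply: fin_bigcap_measurable => // j _.
by apply: counts_level_measurable; have [] := fA j.
Qed.

Lemma counting_law k : P (counting @^-1` [set k]) = (counts_mass k)%:E.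
Proof.
have [_ _ law _ indep] := hN.
have mA j : measurable (A j) by have [] := fA j.
have := indep n A mA tA (fun j => [set (k j)%:R%:E]) (fun j => emeasurable_set1 _).
have -> : P (\bigcap_(i in [set: 'I_n]) (fun w => N w (A i)) @^-1` [set (k i)%:R%:E])
    = P (counting @^-1` [set k]).
  apply: ae_measure_eq; [|exact: counting_measurable|].
    by apply: fin_bigcap_measurable => // j _; exact: prm_level_measurable.
  have := @ae_forall_fin _ _ _ P _ (fun j w => exists k : nat, N w (A j) = k%:R%:E)
    (fun j => prm_ae_nat (fA j)).
  apply: filterS => w Nnat; rewrite level; split=> h j _.
    exact/counts_eq/h.
  have [l Nl] := Nnat j; have := h j I; rewrite /= (counts_eq Nl) => <-; exact: Nl.
move=> ->; rewrite /counts_mass -prodEFin; apply: eq_bigr => j _.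
by rewrite -law//; have [] := fA j.
Qed.

Lemma counts_mass_ge0 k : 0 <= counts_mass k.
Proof.
by apply: prodr_ge0 => j _; apply: poisson_mass_ge0; exact: fine_ge0.
Qed.

Lemma counts_mass_mecke j k :
  fine (mu (A j)) * counts_mass k = (k j).+1%:R * counts_mass (up j k).
Proof.
rewrite /counts_mass (bigD1 j)//= [in RHS](bigD1 j)//= mulrA [RHS]mulrA ffunE eqxx addn1.
rewrite poisson_mass_succ; congr (_ * _); apply: eq_bigr => i /negbTE ij.
by rewrite ffunE ij addn0.
Qed.

End Law.
End Prm.

(** * The Malliavin derivative *)

Section Malliavin.
Context {dO dE : measure_display} {Omega : measurableType dO}.
Context {E : measurableType dE} {R : realType}.
Variables (P : probability Omega R) (mu : {measure set E -> \bar R}).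
Variable N : Omega -> {measure set E -> \bar R}.
Hypothesis hN : poisson_random_measure P mu N.
Context {X : completeNormedModType R}.

(** The real factors of [F] may be given over different families of sets; a
    common disjoint refinement of all of them represents [F]. *)
Lemma malliavin_derivative_exists (F : Omega -> X) : vcylindrical P mu N F ->
  exists DF, is_malliavin_derivative P mu N F DF.
Proof.
move=> [n [Fi [x [n0 Ficyl FE]]]].
have /choice[t ht] : forall i : 'I_n,
    exists t : {M : nat & ((('I_M -> nat) -> R) * ('I_M -> set E))%type},
      (forall m, finite_measure_sets mu ((projT2 t).2 m)) /\
      {ae P, forall w, Fi i w = (projT2 t).1 (counts N (projT2 t).2 w)}.
  by move=> i; have [M [f [B [_ hB hF]]]] := Ficyl i; exists (existT _ M (f, B)).
pose I : finType := {i : 'I_n & 'I_(projT1 (t i))}.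
pose B (u : I) : set E := (projT2 (t (tag u))).2 (tagged u).
have hB u : finite_measure_sets mu (B u) by have [+ _] := ht (tag u); apply.
have [M [A [sigma [M0 fA tA BA]]]] := disjoint_refinement hB.
pose f (i : 'I_n) (k : 'I_M -> nat) : R := (projT2 (t i)).1
  (fun m => (\sum_(j in sigma (Tagged (fun i => 'I_(projT1 (t i))) m : I)) k j)%N).
exists (malliavin_repr N f A x), n, M, f, A, x; split => //.
have Fae := @ae_forall_fin _ _ _ P _
  (fun i w => Fi i w = (projT2 (t i)).1 (counts N (projT2 (t i)).2 w))
  (fun i => (ht i).2).
have cae := prm_counts_additive hN fA tA BA.
apply: filterS2 (filterI Fae cae) FE => w [Fw cw] FwE.
rewrite FwE; apply: eq_bigr => i _.
rewrite Fw /f; have -> // : counts N (projT2 (t i)).2 w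
  = fun m => (\sum_(j in sigma (Tagged (fun i => 'I_(projT1 (t i))) m : I))
               counts N A w j)%N.
apply/funext => m.
exact: counts_eq (cw (Tagged (fun i => 'I_(projT1 (t i))) m : I)).
Qed.

(** For a fixed outcome the derivative is a simple function on [E]. *)
Lemma malliavin_repr_integral (n M : nat) (f : 'I_n -> ('I_M -> nat) -> R)
    (A : 'I_M -> set E) (x : 'I_n -> X) (B : set E) (w : Omega) :
  measurable B -> (forall m, finite_measure_sets mu (A m)) ->
  bochner_integral mu B (malliavin_repr N f A x w)
  = \sum_(m < M) fine (mu (A m `&` B)) *:
      (\sum_(i < n) f i (add_unit (counts N A w) m) *: x i
       - \sum_(i < n) f i (counts N A w) *: x i).
Proof.
move=> mB fA.
pose d m := \sum_(i < n) f i (add_unit (counts N A w) m) *: x i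
       - \sum_(i < n) f i (counts N A w) *: x i.
pose s := [seq (A m, d m) | m <- enum 'I_M].
have hs : is_mu_simple mu B s.
  move=> q /mapP[m _ ->] /=; have [mA Afin] := fA m; split => //.
  apply: (measure_sub_lty _ mA _ Afin); first exact: measurableI.
  exact: subIsetl.
have -> : malliavin_repr N f A x w = simple_fun s.
  apply/funext => e; rewrite /simple_fun big_map big_enum /malliavin_repr exchange_big/=.
  apply: eq_bigr => m _; rewrite /d -sumrB scaler_sumr; apply: eq_bigr => i _.
  by rewrite -scalerBl !scalerA mulrC.
rewrite bochner_integral_simple// /simple_integral big_map big_enum.
by apply: eq_bigr.
Qed.

(** Cutting the sets [B m] of a representation along [C] turns the integral of
    the derivative over [C] into a weighted sum of increments in the directions
    of the pieces contained in [C]. *)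
Lemma gradient_refinement (M n : nat) (G : ('I_M -> nat) -> X)
    (B : 'I_M -> set E) (C : set E) (A : 'I_n -> set E)
    (sigma : option 'I_M -> {set 'I_n}) (k : {ffun 'I_n -> nat}) :
  trivIset [set: 'I_M] B ->
  (forall j, finite_measure_sets mu (A j)) -> trivIset [set: 'I_n] A ->
  (forall m, B m = \big[setU/set0]_(j in sigma (Some m)) A j) ->
  C = \big[setU/set0]_(j in sigma None) A j ->
  let merge (l : {ffun 'I_n -> nat}) m := (\sum_(j in sigma (Some m)) l j)%N in
  \sum_(m < M) fine (mu (B m `&` C)) *: (G (add_unit (merge k) m) - G (merge k))
  = gradient (fun j => fine (mu (A j))) (sigma None) (fun l => G (merge l)) k.
Proof.
move=> tB fA tA BA CA merge.
have muBC m : fine (mu (B m `&` C))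
    = \sum_(j in sigma None | j \in sigma (Some m)) fine (mu (A j)).
  have -> : B m `&` C = \big[setU/set0]_(j in sigma None :&: sigma (Some m)) A j.
    rewrite BA CA !bigsetUE; apply/seteqP; split=> e.
      move=> [[j js Aj] [j' js' Aj']].
      have jj' : j = j' by apply: tA => //; exists e.
      by exists j => //; rewrite inE js andbT jj'.
    by move=> [j]; rewrite inE => /andP[j1 j2] Aj; split; exists j.
  rewrite measure_bigsetU_ord//; last by move=> j; have [] := fA j.
  rewrite -sum_fine; first by apply: eq_bigl => j; rewrite inE.
  by move=> j _; rewrite ge0_fin_numE//; have [] := fA j.
under eq_bigr do rewrite muBC scaler_suml.
rewrite (exchange_big_dep (fun j => j \in sigma None))/=; last first.
  by move=> m j _ /andP[].
rewrite /gradient; apply: eq_bigr => j jS.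
have mergeE m : merge (up j k) m = (merge k m + (j \in sigma (Some m)))%N.
  rewrite /merge; under eq_bigr do rewrite ffunE.
  rewrite big_split/=; congr (_ + _)%N.
  case: (boolP (j \in sigma (Some m))) => js.
    rewrite (bigD1 j)//= eqxx big1// => i /andP[_ /negbTE ->]; done.
  rewrite big1// => i iS; case: eqP => // ij; by rewrite -ij iS in js.
(* an empty piece may belong to several sets of the representation, but it
   contributes nothing *)
have [Aj0|] := pselect (A j = set0).
  by rewrite Aj0 measure0 /= scale0r big1// => m _; rewrite scale0r.
move=> /eqP/set0P[e Aje].
under eq_bigl do rewrite jS.
have [[m jm]|nm] := pselect (exists m, j \in sigma (Some m)).
  have uniq_m m' : j \in sigma (Some m') -> m' = m.
    move=> jm'; apply: tB => //; exists e.
    by split; rewrite BA bigsetUE; exists j.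
  rewrite (bigD1 m)//= big1 ?addr0; last first.
    by move=> m' /andP[/uniq_m -> /eqP].
  congr (_ *: (G _ - _)); apply/funext => m'.
  rewrite mergeE /add_unit; congr (_ + nat_of_bool _)%N.
  by apply/eqP/idP => [->//|/uniq_m].
rewrite big1; last by move=> m jm; exfalso; apply: nm; exists m.
have -> : merge (up j k) = merge k.
  apply/funext => m; rewrite mergeE; case: (boolP (j \in _)) => [jm|_].
    by exfalso; apply: nm; exists m.
  by rewrite addn0.
by rewrite subrr scaler0.
Qed.

End Malliavin.

Theorem proposition5p5 (R : realType)
  (dO : measure_display) (Omega : measurableType dO) (P : probability Omega R)
  (dE : measure_display) (E : measurableType dE)
  (mu : {sigma_finite_measure set E -> \bar R})
  (N : Omega -> {measure set E -> \bar R})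
  (hN : poisson_random_measure P mu N)
  (X : completeNormedModType R)
  (F : Omega -> X) (hF : vcylindrical P mu N F)
  (B : set E) (hB : finite_measure_sets mu B)
  (hDF : bochner_integrable P [set: Omega]
           (fun w => bochner_integral mu B (malliavin P mu N F w)))
  (hNF : bochner_integrable P [set: Omega]
           (fun w => compensated mu N B w *: F w)) :
  bochner_integral P [set: Omega]
    (fun w => bochner_integral mu B (malliavin P mu N F w))
  = bochner_integral P [set: Omega]
      (fun w => compensated mu N B w *: F w).
Proof.
have [DF0 hDF0] := malliavin_derivative_exists hN hF.
have : is_malliavin_derivative P mu N F (malliavin P mu N F).
  rewrite /malliavin; case: xgetP => [DF _ //|/(_ DF0)]; exact.
move=> [n [M [f [A [x [_ fA tA FE DFE]]]]]].
have [v1 hv1] := hDF; have [v2 hv2] := hNF.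
rewrite (bochner_integralE measurableT hv1) (bochner_integralE measurableT hv2).
have mB : measurable B by have [] := hB.
pose G (c : 'I_M -> nat) := \sum_(i < n) f i c *: x i.
(* the sets to be refined: those of the representation, and [B] at [None] *)
pose A' (o : option 'I_M) := if o is Some m then A m else B.
have fA' o : finite_measure_sets mu (A' o) by case: o => [m|]; [exact: fA|exact: hB].
have [l [a [sigma [_ fa ta A'a]]]] := disjoint_refinement fA'.
have Aa m : A m = \big[setU/set0]_(j in sigma (Some m)) a j := A'a (Some m).
have Ba : B = \big[setU/set0]_(j in sigma None) a j := A'a None.
have cae := prm_counts_additive hN fa ta A'a.
pose S := sigma None; pose lam j := fine (mu (a j)).
pose merge (k : {ffun 'I_l -> nat}) m := (\sum_(j in sigma (Some m)) k j)%N.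
pose g k := G (merge k); pose K := counting N a.
have mergeK : {ae P, forall w, counts N A w = merge (K w)}.
  apply: filterS cae => w cw; apply/funext => m; rewrite (counts_eq (cw (Some m))).
  by apply: eq_bigr => j _; rewrite ffunE.
have hD : {ae P, forall w, bochner_integral mu B (malliavin P mu N F w)
    = gradient lam S g (K w)}.
  apply: filterS mergeK => w cw; rewrite DFE malliavin_repr_integral// cw.
  exact: (gradient_refinement G (K w) tA fa ta Aa Ba).
have hC : {ae P, forall w, compensated mu N B w *: F w = centred lam S g (K w)}.
  apply: filterS3 FE mergeK cae => w -> -> cw; rewrite /compensated /centred.
  rewrite (cw None) /=; congr ((_%:R - _) *: _).
    by apply: eq_bigr => j _; rewrite ffunE.
  rewrite {1}Ba measure_bigsetU_ord//; last by move=> j; have [] := fa j.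
  by rewrite -sum_fine// => j _; rewrite ge0_fin_numE//; have [] := fa j.
have mK := counting_measurable hN fa.
have lawK k : fine (P (K @^-1` [set k])) = counts_mass mu a k.
  by rewrite (counting_law hN fa ta).
have lam0 j : 0 <= lam j by exact: fine_ge0.
apply: (mecke_sum lam0 (counts_mass_ge0 mu a) (counts_mass_mecke mu a)
  (S := S) (g := g)).
- have := bochner_discrete_summable mK hD hv1.
  by under eq_esum do rewrite lawK.
- have := bochner_discrete_summable mK hC hv2.
  by under eq_esum do rewrite lawK.
- move=> U uU; have := bochner_discrete_tail mK hD hv1 uU.
  under eq_bigr do rewrite lawK.
  by under eq_esum do rewrite lawK.
- move=> U uU; have := bochner_discrete_tail mK hC hv2 uU.
  under eq_bigr do rewrite lawK.
  by under eq_esum do rewrite lawK.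
Qed.
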